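(* Let $q\in S^1$ and $m\in\mathbb{Z}$. Then the set $P_m^q(S^1,S^1)$ is dense in $C_m^q(S^1,S^1)$ with respect to the metric $d_0$.
   Context: $S^1=\{(x,y)\in\mathbb{R}^2: x^2+y^2=1\}$, $I=[0,1]$, and $C(S^1,S^1)$ is the set of all continuous functions from $S^1$ to $S^1$. Let $\alpha:[0,1]\to S^1$, $\alpha(t)=(\cos 2\pi t,\sin 2\pi t)$, and let $p:\mathbb{R}\to S^1$, $p(t)=(\cos 2\pi t,\sin 2\pi t)$, be the covering map. For $f\in C(S^1,S^1)$, let $\tilde{f_\alpha}:I\to\mathbb{R}$ be the unique continuous map with $p\circ\tilde{f_\alpha}=f\circ\alpha$ and $\tilde{f_\alpha}(0)\in[0,1)$. For $x\in S^1$, $x\neq(1,0)$, $\alpha^{-1}(x)$ denotes the unique $t\in(0,1)$ with $\alpha(t)=x$. The metric $d_0$ on $C(S^1,S^1)$ is $$d_0(f,g)=2\pi\sup_{x\in S^1,\ x\neq(1,0)}\left|\tilde{f_\alpha}(\alpha^{-1}(x))-\tilde{g_\alpha}(\alpha^{-1}(x))\right|.$$ The winding number of $f\in C(S^1,S^1)$ is the integer $W(f)=\tilde{f_\alpha}(1)-\tilde{f_\alpha}(0)$. For $a,b\in\mathbb{R}$, $P_{a,b}(I,\mathbb{R})$ is the set of real polynomials $r(x)$ with $r(0)=a$ and $r(1)=b$, regarded as functions on $I$. For $q\in S^1$, let $\tilde q$ be the unique element of $[0,1)$ with $p(\tilde q)=q$. For $q\in S^1$ and $m\in\mathbb{Z}$,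 $$C_m^q(S^1,S^1)=\{f\in C(S^1,S^1): f((1,0))=q,\ W(f)=m\},$$ $$P_m^q(S^1,S^1)=\{f\in C(S^1,S^1): \tilde{f_\alpha}\in P_{\tilde q,\tilde q+m}(I,\mathbb{R}),\ p\circ\tilde{f_\alpha}(0)=q\}.$$ *)

(* Defs.v *)
From HB Require Import structures.
From mathcomp Require Import all_boot all_order all_algebra.
From mathcomp Require Import all_classical all_reals all_analysis.
Import Order.TTheory GRing.Theory Num.Theory.
Import numFieldNormedType.Exports.

Set Implicit Arguments.
Unset Strict Implicit.
Unset Printing Implicit Defensive.

Local Open Scope classical_set_scope.
Local Open Scope ring_scope.

Definition circle (R : realType) : set (R * R) :=
  [set z | z.1 ^+ 2 + z.2 ^+ 2 = 1].

(* [S1 R] and [unitI R] carry the topologies induced by R * R and R. *)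
Notation S1 R := (set_type (@circle R)).
Notation unitI R := (set_type (`[0, 1]%classic : set R)).

(* The set C(S^1, S^1). *)
Notation CS1 R := (continuousType (S1 R) (S1 R)).

Lemma circleP (R : realType) (t : R) :
  (cos (2 * pi * t), sin (2 * pi * t)) \in @circle R.
Proof. by rewrite inE /circle /= cos2Dsin2. Qed.

Lemma circle10 (R : realType) : ((1, 0) : R * R) \in @circle R.
Proof. by rewrite inE /circle /= expr1n expr0n addr0. Qed.

Lemma I0_subproof (R : realType) : (0 : R) \in (`[0, 1]%classic : set R).
Proof. by rewrite inE /= in_itv /= lexx ler01. Qed.

Lemma I1_subproof (R : realType) : (1 : R) \in (`[0, 1]%classic : set R).
Proof. by rewrite inE /= in_itv /= lexx ler01. Qed.

Definition I0 (R : realType) : unitI R := SigSub (I0_subproof R).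
Definition I1 (R : realType) : unitI R := SigSub (I1_subproof R).
Definition base (R : realType) : S1 R := SigSub (circle10 R).

Definition cover_p (R : realType) (t : R) : S1 R := SigSub (circleP t).
Definition alpha (R : realType) (t : unitI R) : S1 R := cover_p (val t).

(* The definite descriptions of the text are rendered by [get] and [xget]; the
   default values are irrelevant, since each description is satisfied by exactly
   one element (for [alpha_inv], when x differs from (1, 0)). *)

Definition alpha_inv (R : realType) (x : S1 R) : unitI R :=
  xget (I0 R) [set t : unitI R | 0 < val t < 1 /\ alpha t = x].

Definition lift_alpha (R : realType) (f : CS1 R) : unitI R -> R :=
  get [set h : unitI R -> R |
    [/\ continuous h, forall t, cover_p (h t) = f (alpha t) & 0 <= h (I0 R) < 1]].

Definition qtilde (R : realType) (q : S1 R) : R :=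
  get [set t : R | 0 <= t < 1 /\ cover_p t = q].

Definition d0 (R : realType) (f g : CS1 R) : R :=
  2 * pi * sup [set `|lift_alpha f (alpha_inv x) - lift_alpha g (alpha_inv x)|
               | x in [set x : S1 R | x <> base R]].

Definition winding (R : realType) (f : CS1 R) : R :=
  lift_alpha f (I1 R) - lift_alpha f (I0 R).

Definition poly_ab (R : realType) (a b : R) : set (unitI R -> R) :=
  [set (fun t : unitI R => r.[val t])
  | r in [set r : {poly R} | r.[0] = a /\ r.[1] = b]].

Definition Cqm (R : realType) (q : S1 R) (m : int) : set (CS1 R) :=
  [set f : CS1 R | f (base R) = q /\ winding f = m%:~R].

Definition Pqm (R : realType) (q : S1 R) (m : int) : set (CS1 R) :=
  [set f : CS1 R | poly_ab (qtilde q) (qtilde q + m%:~R) (lift_alpha f)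
                  /\ cover_p (lift_alpha f (I0 R)) = q].

Definition dense_in (R : realType) (T : Type) (d : T -> T -> R) (A B : set T) :=
  A `<=` B /\
  forall f, B f -> forall e : R, 0 < e -> exists2 g, A g & d f g < e.

(* Main.v *)
(* For f in C_m^q the lift F of f o alpha is a continuous real function on
   [0,1] with F(0) = q~ and F(1) = q~ + m. The Bernstein polynomials of F
   converge uniformly to F and interpolate it at 0 and 1. Such a polynomial r
   takes congruent values mod 1 at the end points, so p o r factors through the
   quotient map alpha as g o alpha with g continuous; uniqueness of lifts then
   identifies the lift of g with r. *)
Require Import Defs.
From mathcomp Require Import all_boot all_order all_algebra.
From mathcomp Require Import all_classical all_reals all_analysis.
From mathcomp Require Import ring lra.
Import Order.TTheory GRing.Theory Num.Theory.
Import numFieldNormedType.Exports.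

Set Implicit Arguments.
Unset Strict Implicit.
Unset Printing Implicit Defensive.

Local Open Scope classical_set_scope.
Local Open Scope ring_scope.

(** * Continuity with respect to subspace and product topologies *)

Lemma continuous_to_set_type {X Y : topologicalType} (A : set Y) (f : X -> A) :
  continuous (fun x => val (f x)) -> continuous f.
Proof. exact: (@continuous_comp_initial _ _ _ set_val f). Qed.

Lemma continuous_val {X : topologicalType} (A : set X) :
  continuous (val : A -> X).
Proof. exact: (@initial_continuous _ _ set_val). Qed.

Lemma continuous_pair {X Y Z : topologicalType} (f : X -> Y) (g : X -> Z) x :
  {for x, continuous f} -> {for x, continuous g} ->
  {for x, continuous (fun y => (f y, g y))}.
Proof. by move=> cf cg; exact: (cvg_pair cf cg). Qed.

(** * The covering map of the circle and oriented angles *)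

Section Circle.
Context {R : realType}.
Implicit Types (s t d : R) (z w : S1 R).

(** Half-angle formula: 1 - cos(2 pi |d|) = 2 sin^2(pi |d|), and pi |d| lies strictly between 0 and
    pi when [d] is nonzero. *)
Lemma cos2pi_eq1_small d : `|d| < 1 -> cos (2 * pi * d) = 1 -> d = 0.
Proof.
move=> d1 c1; apply/eqP/contraT => d0.
have : 0 < sin (pi * `|d|).
  apply: sin_gt0_pi; rewrite mulr_gt0 ?pi_gt0 ?normr_gt0 //=.
  by rewrite gtr_pMr ?pi_gt0.
have : cos (2 * pi * `|d|) = 1 by case: (ger0P d) => // _; rewrite mulrN cosN.
rewrite -mulrA mulr_natl cos_mulr2n => c2.
have : sin (pi * `|d|) ^+ 2 = 0 by rewrite sin2cos2; lra.
by move=> /eqP; rewrite sqrf_eq0 => /eqP ->; rewrite ltxx.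
Qed.

(** The cosine is the inner product of the two points. This form keeps integers out: with
    [cos2pi_eq1_small] it gives [s = t] as soon as [s] and [t] are less than 1 apart. *)
Lemma cover_p_eqP s t :
  cover_p s = cover_p t <-> cos (2 * pi * (s - t)) = 1.
Proof.
split=> [/(congr1 val) [es et]|c1].
  by rewrite mulrBr cosB es et -!expr2 cos2Dsin2.
have s0 : sin (2 * pi * (s - t)) = 0.
  by apply/eqP; rewrite -sqrf_eq0 sin2cos2 c1 expr1n subrr.
apply: val_inj => /=.
have -> : 2 * pi * s = 2 * pi * (s - t) + 2 * pi * t by ring.
by rewrite cosD sinD c1 s0 !mul1r !mul0r subr0 add0r.
Qed.

Lemma cover_p_inj01 s t :
  0 <= s < 1 -> 0 <= t < 1 -> cover_p s = cover_p t -> s = t.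
Proof.
move=> /andP[s0 s1] /andP[t0 t1] /cover_p_eqP /cos2pi_eq1_small st.
by apply/eqP; rewrite -subr_eq0; apply/eqP/st; rewrite ltr_norml; lra.
Qed.

Lemma S1_eq z : (val z).1 ^+ 2 + (val z).2 ^+ 2 = 1.
Proof. by case: z => z /= /set_mem. Qed.

(** [acos] of the first coordinate parametrizes the upper half circle; the lower half follows by the
    reflection t -> 1 - t. *)
Lemma cover_p_surj z : exists2 t, 0 <= t < 1 & cover_p t = z.
Proof.
have := S1_eq z; case: z => -[x y] /= zP e.
have x1 : -1 <= x <= 1.
  rewrite -ler_norml -(ler_pXn2r (n := 2)) ?nnegrE //.
  by rewrite expr1n real_normK ?num_real //; nra.
have pi0 := pi_gt0 R.
have a0 : 0 <= acos x := acos_ge0 x1.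
have api : acos x <= pi := acos_lepi x1.
have cx : cos (acos x) = x by apply: acosK.
have sx : sin (acos x) = `|y|.
  by rewrite sin_acos // -sqrtr_sqr; congr Num.sqrt; lra.
have pi20 : 2 * pi != 0 :> R by rewrite mulf_neq0 ?lt0r_neq0.
case: (leP 0 y) => y0.
  exists (acos x / (2 * pi)).
    have tpi : 0 < 2 * pi :> R by rewrite mulr_gt0.
    by rewrite divr_ge0 ?(ltW tpi) //= ltr_pdivrMr //; lra.
  apply: val_inj => /=; rewrite mulrC divfK // cx sx ger0_norm //.
(* As [y < 0] excludes x = 1, the angle is positive, which keeps the reflected parameter strictly
   below 1. *)
have an0 : 0 < acos x.
  apply: acos_gt0; case/andP: x1 => -> /=.
  by rewrite le_eqVlt => /orP[/eqP x1|//]; nra.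
exists (1 - acos x / (2 * pi)).
  have h1 : 0 < acos x / (2 * pi) by rewrite divr_gt0 ?mulr_gt0.
  have h2 : acos x / (2 * pi) <= 1 by rewrite ler_pdivrMr ?mulr_gt0 //; lra.
  lra.
apply: val_inj => /=.
have -> : 2 * pi * (1 - acos x / (2 * pi)) = - acos x + pi *+ 2.
  by rewrite mulrBr mulr1 [_ * (_ / _)]mulrC divfK // mulr_natl addrC.
by rewrite cosD2pi sinD2pi cosN sinN cx sx ltr0_norm // opprK.
Qed.

Lemma continuous_cover_p : continuous (@cover_p R).
Proof.
apply: continuous_to_set_type => t.
have c2 : {for t, continuous (fun u : R => 2 * pi * u)} by apply: mulrl_continuous.
apply: continuous_pair.
  exact: (continuous_comp c2 (@continuous_cos R _)).
exact: (continuous_comp c2 (@continuous_sin R _)).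
Qed.

(** [cdot] and [ccross] are the cosine and the sine of the oriented angle from [z] to [w]. *)
Definition cdot z w := (val z).1 * (val w).1 + (val z).2 * (val w).2.
Definition ccross z w := (val z).1 * (val w).2 - (val z).2 * (val w).1.

(* The signed angle from [z] to [w], in turns, when it is acute. *)
Definition turn z w := asin (ccross z w) / (2 * pi).

(** Lagrange's identity for two unit vectors. *)
Lemma cdot2Dccross2 z w : cdot z w ^+ 2 + ccross z w ^+ 2 = 1.
Proof.
have := S1_eq z; have := S1_eq w; rewrite /cdot /ccross => hw hz.
by rewrite -[RHS](mulr1 1) -{1}hw -{1}hz; ring.
Qed.

Lemma ccross_lt1 z w : 0 < cdot z w -> -1 < ccross z w < 1.
Proof. by move=> d0; have := cdot2Dccross2 z w; nra. Qed.

Lemma turnxx z : turn z z = 0.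
Proof.
have c0 : ccross z z = 0 by rewrite /ccross; ring.
rewrite /turn c0 -[X in asin X]sin0 sinK ?mul0r //.
by rewrite in_itv /= oppr_le0 divr_ge0 ?pi_ge0.
Qed.

(** A positive cosine puts the angle in (-pi/2, pi/2), where [asin] recovers it from its sine; the
    addition formulas then rotate [z] onto [w]. *)
Lemma cover_pD_turn z w s :
  0 < cdot z w -> cover_p s = z -> cover_p (s + turn z w) = w.
Proof.
move=> + sz; rewrite -{}sz => d0; have /andP[c1 c2] := ccross_lt1 d0.
have pi20 : 2 * pi != 0 :> R by rewrite mulf_neq0 ?lt0r_neq0 ?pi_gt0.
have e : 2 * pi * (s + turn (cover_p s) w) = 2 * pi * s + asin (ccross (cover_p s) w).
  by rewrite mulrDr [_ * turn _ _]mulrC divfK.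
have sa : sin (asin (ccross (cover_p s) w)) = ccross (cover_p s) w.
  by apply: asinK; rewrite in_itv /= !ltW.
have ca : cos (asin (ccross (cover_p s) w)) = cdot (cover_p s) w.
  rewrite cos_asin ?(ltW c1) ?(ltW c2) // -[RHS]ger0_norm ?(ltW d0) // -sqrtr_sqr.
  by congr Num.sqrt; have := cdot2Dccross2 (cover_p s) w; lra.
have := S1_eq (cover_p s); move: sa ca; rewrite /cdot /ccross /= => sa ca hz.
apply: val_inj; rewrite /= e cosD sinD sa ca; case: (val w) => a b /=.
set c := cos _ in hz *; set d := sin _ in hz *.
congr pair; [rewrite -[RHS]mulr1 -hz|rewrite -[RHS]mulr1 -hz]; ring.
Qed.

End Circle.
(** Heine-Cantor. Compactness is used in its near-covering form, along the filter of radii tending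
    to 0 from the right, so that one radius serves all points. *)
Lemma compact_unif_continuous {R : realType} {X Y : pseudoMetricType R}
    (f : X -> Y) :
  compact [set: X] -> continuous f -> unif_continuous f.
Proof.
move=> /compact_near_coveringP cX cf; apply/unif_continuousP => e e0.
have e20 : 0 < e / 2 by rewrite divr_gt0.
have [|] := @cX R 0^'+ (fun d x => forall y, ball x d y -> ball (f x) e (f y)).
  move=> x _; have /cf /= : nbhs (f x) (ball (f x) (e / 2)) by exact: nbhsx_ballx.
  move=> /nbhs_ballP[d /= d0 dP].
  have d20 : 0 < d / 2 by rewrite divr_gt0.
  exists (ball x (d / 2), [set u | u < d / 2]) => /=.
    by split; [exact: nbhsx_ballx | exact: nbhs_right_lt].
  move=> [x' u] /= [xx' ud] y x'y.
  apply: (@ball_splitr _ _ (f x)); apply: dP.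
    by apply: le_ball xx'; rewrite ler_pdivrMr // ler_pMr // ?ler1n.
  by apply: (@ball_split _ _ x') => //; apply: le_ball x'y; exact: ltW.
move=> d /= d0 H; exists (d / 2); first by rewrite /= divr_gt0.
move=> [x y] /= xy; apply: (H (d / 2)) => //=; last by rewrite divr_gt0.
by rewrite sub0r normrN gtr0_norm ?divr_gt0 // ltr_pdivrMr // ltr_pMr // ltr1n.
Qed.

(** * The unit interval as a subtype of the reals *)

Section UnitInterval.
Context {R : realType}.
Implicit Types (x y : R) (t : unitI R).

Lemma clamp_subproof x : Num.max 0 (Num.min 1 x) \in (`[0, 1]%classic : set R).
Proof. by rewrite inE /= in_itv /= le_max lexx /= ge_max ler01 ge_min lexx. Qed.

(** The retraction of the line onto [0, 1]. It makes points of the subtype without membership proofs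
    and carries compactness and connectedness over from the segment. *)
Definition clamp x : unitI R := SigSub (clamp_subproof x).

Lemma unitIP t : 0 <= val t <= 1.
Proof. by case: t => t /= /set_mem /=; rewrite in_itv. Qed.

Lemma val_clamp x : 0 <= x <= 1 -> val (clamp x) = x.
Proof. by move=> /andP[x0 x1] /=; rewrite min_r // max_r. Qed.

Lemma clampK t : clamp (val t) = t.
Proof. by apply: val_inj; rewrite val_clamp // unitIP. Qed.

Lemma clamp0 : clamp 0 = I0 R.
Proof. by apply: val_inj; rewrite val_clamp // lexx ler01. Qed.

Lemma clamp1 : clamp 1 = I1 R.
Proof. by apply: val_inj; rewrite val_clamp // lexx ler01. Qed.

Lemma continuous_clamp : continuous clamp.
Proof.
apply: continuous_to_set_type => x /=.
apply: (@continuous_max R R^o (cst 0) (fun y => Num.min 1 y)).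
  exact: cst_continuous.
by apply: (@continuous_min R R^o (cst 1) id); [exact: cst_continuous|exact: cvg_id].
Qed.

Lemma continuous_clampM (a : R) : continuous (fun t => clamp (a * val t)).
Proof.
move=> t.
apply: (@continuous_comp (unitI R) R (unitI R) (fun s => a * val s)).
  apply: (@continuous_comp (unitI R) R R (fun s => val s)).
    exact: continuous_val.
  exact: mulrl_continuous.
exact: continuous_clamp.
Qed.

Lemma clamp_image : clamp @` `[0, 1] = [set: unitI R].
Proof.
apply/seteqP; split => // t _; exists (val t); last exact: clampK.
by rewrite /= in_itv /= unitIP.
Qed.

Lemma unitI_compact : compact [set: unitI R].
Proof.
rewrite -clamp_image; apply: continuous_compact; last exact: segment_compact.
exact/continuous_subspaceT/continuous_clamp.
Qed.

Lemma unitI_connected : connected [set: unitI R].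
Proof.
rewrite -clamp_image; apply: connected_continuous_connected.
  exact: segment_connected.
exact/continuous_subspaceT/continuous_clamp.
Qed.

End UnitInterval.

(** * Existence and uniqueness of lifts *)

Section Lifting.
Context {R : realType}.
Implicit Types (z w : S1 R).

(** For unit vectors, twice the inner product is 2 - |z - w|^2 with the Euclidean norm; balls are
    those of the max norm, so both squared coordinate differences are below 1. *)
Lemma cdot_gt0_ball z w : ball z (1 : R) w -> 0 < cdot z w.
Proof.
move=> zw; have h1 : `|(val z).1 - (val w).1| < 1 := zw.1.
have h2 : `|(val z).2 - (val w).2| < 1 := zw.2.
have := S1_eq z; have := S1_eq w.
rewrite /cdot; move: (val z) (val w) h1 h2 => [a b] [c d] /=.
rewrite !ltr_norml => /andP[ac1 ac2] /andP[bd1 bd2] cd1 ab1.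
have ac : 0 < (1 - (a - c)) * (1 + (a - c)) by apply: mulr_gt0; lra.
have bd : 0 < (1 - (b - d)) * (1 + (b - d)) by apply: mulr_gt0; lra.
nra.
Qed.

(** Positivity at [x] keeps the cross product inside (-1, 1), where [asin] is continuous. *)
Lemma continuous_turn {X : topologicalType} (u v : X -> S1 R) x :
  {for x, continuous u} -> {for x, continuous v} -> 0 < cdot (u x) (v x) ->
  {for x, continuous (fun y => turn (u y) (v y))}.
Proof.
move=> cu cv d0.
have cval (a : X -> S1 R) : {for x, continuous a} ->
    val (a y) @[y --> x] --> val (a x).
  by move=> ca; apply: (continuous_comp ca); exact: continuous_val.
have c1 (a : X -> S1 R) : {for x, continuous a} ->
    (val (a y)).1 @[y --> x] --> (val (a x)).1.
  by move=> /cval ca; apply: (cvg_comp _ _ ca); exact: cvg_fst.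
have c2 (a : X -> S1 R) : {for x, continuous a} ->
    (val (a y)).2 @[y --> x] --> (val (a x)).2.
  by move=> /cval ca; apply: (cvg_comp _ _ ca); exact: cvg_snd.
apply: cvgM; last exact: cvg_cst.
apply: (@continuous_comp _ _ _ (fun y => ccross (u y) (v y))).
  by apply: cvgB; apply: cvgM; [apply: c1|apply: c2|apply: c2|apply: c1].
by apply: continuous_asin; exact: ccross_lt1.
Qed.

(** The distance |h - k| is continuous, starts at 0 and takes only values [v] with cos(2 pi v) = 1.
    To reach 1 it would have to pass through 1/2; staying below 1, it vanishes. *)
Lemma lift_unique (h k : unitI R -> R) :
  continuous h -> continuous k -> (forall t, cover_p (h t) = cover_p (k t)) ->
  h (I0 R) = k (I0 R) -> h = k.
Proof.
move=> ch ck hk hk0; apply/funext => t.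
pose D s := `|h s - k s|.
have cD : continuous D.
  by move=> s; exact: (cvg_norm (cvgB (ch s) (ck s))).
have D1 s : cos (2 * pi * D s) = 1.
  rewrite /D; case: (ger0P (h s - k s)) => _; first exact/cover_p_eqP.
  by rewrite mulrN cosN; exact/cover_p_eqP.
have iD : is_interval (range D).
  apply/connected_intervalP/connected_continuous_connected.
    exact: unitI_connected.
  exact: continuous_subspaceT.
have [Dt|Dt] := ltP (D t) 1.
  apply/eqP; rewrite -subr_eq0 -normr_eq0; apply/eqP.
  by apply: (cos2pi_eq1_small _ (D1 t)); rewrite /D normr_id.
have [s _ Ds] : range D (2^-1).
  apply: (iD (D (I0 R)) (D t)); [by exists (I0 R)|by exists t|].
  by rewrite /D hk0 subrr normr0 invr_ge0 ler0n /=; apply: le_trans Dt; lra.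
have := D1 s; rewrite Ds => /cos2pi_eq1_small.
by move=> /(_ ltac:(rewrite ger0_norm; lra)); lra.
Qed.

(* Since [u] is uniformly continuous, [u (t n/N)] and [u (t (n+1)/N)] are less
   than a quarter turn apart for N large, and the signed angles between them
   depend continuously on t; the lift adds them up. *)
Lemma lift_exists (u : unitI R -> S1 R) : continuous u ->
  exists h : unitI R -> R,
    [/\ continuous h, forall t, cover_p (h t) = u t & 0 <= h (I0 R) < 1].
Proof.
move=> cu; have [th0 th01 uth0] := cover_p_surj (u (I0 R)).
(* The tolerance 1 is the radius in [cdot_gt0_ball]. *)
have /unif_continuousP/(_ 1 ltr01)[d /= d0 ud] :=
  compact_unif_continuous unitI_compact cu.
pose N := (Num.bound d^-1).+1.
have N0 : 0 < N%:R :> R by rewrite ltr0n.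
have Nd : N%:R^-1 < d.
  rewrite invf_plt ?posrE //; apply: (@lt_trans _ _ (Num.bound d^-1)%:R).
    by apply: archi_boundP; rewrite invr_ge0 ltW.
  by rewrite ltr_nat.
(* For n <= N the argument already lies in [0, 1], so [clamp] only adjusts the type. *)
pose c n (t : unitI R) : unitI R := clamp (n%:R / N%:R * val t).
have cc n : continuous (c n) by exact: continuous_clampM.
have vc n t : (n <= N)%N -> val (c n t) = n%:R / N%:R * val t.
  move=> nN; have /andP[t0 t1] := unitIP t.
  have n1 : n%:R / N%:R <= 1 :> R by rewrite ler_pdivrMr // mul1r ler_nat.
  have n0 : 0 <= n%:R / N%:R :> R by rewrite divr_ge0.
  by rewrite val_clamp // mulr_ge0 //= mulr_ile1.
(* Stage [n] lifts the path t -> u(n t / N); the stages lead from a constant path to [u] itself. *)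
have H n : (n <= N)%N -> exists h : unitI R -> R,
    [/\ continuous h, forall t, cover_p (h t) = u (c n t) & h (I0 R) = th0].
  elim: n => [_|n IH nN].
    exists (cst th0); split => // [|t]; first exact: cst_continuous.
    by rewrite uth0 /c !mul0r clamp0.
  have [h [ch hu h0]] := IH (ltnW nN).
  have near t : 0 < cdot (u (c n t)) (u (c n.+1 t)).
    apply/cdot_gt0_ball/(ud (c n t, c n.+1 t)).
    suff : `|val (c n t) - val (c n.+1 t)| < d by [].
    rewrite !vc ?(ltnW nN) //; apply: le_lt_trans Nd.
    have /andP[t0 t1] := unitIP t.
    rewrite -!mulrBl -natr1 opprD addrA subrr sub0r mulNr mul1r.
    by rewrite mulNr normrN ger0_norm ?mulr_ge0 ?invr_ge0 ?ler0n // ler_piMr ?invr_ge0.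
  exists (fun t => h t + turn (u (c n t)) (u (c n.+1 t))); split.
  - move=> t; apply: (cvgD (ch t)); apply: continuous_turn (near t).
      exact: (continuous_comp (@cc n t) (cu _)).
    exact: (continuous_comp (@cc n.+1 t) (cu _)).
  - by move=> t; exact: cover_pD_turn.
  - by rewrite h0 /c !mulr0 turnxx addr0.
have [h [ch hu h0]] := H N (leqnn _); exists h; split=> [//|t|]; last by rewrite h0.
by rewrite hu /c divff ?lt0r_neq0 // mul1r clampK.
Qed.

Lemma continuous_alpha : continuous (@alpha R).
Proof.
move=> t; apply: (@continuous_comp (unitI R) R (S1 R) (fun s => val s)).
  exact: continuous_val.
exact: continuous_cover_p.
Qed.

Lemma lift_alphaP (f : CS1 R) :
  [/\ continuous (lift_alpha f),
      forall t, cover_p (lift_alpha f t) = f (alpha t) &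
      0 <= lift_alpha f (I0 R) < 1].
Proof.
apply: (getPex (P := [set h : unitI R -> R |
  [/\ continuous h, forall t, cover_p (h t) = f (alpha t) & 0 <= h (I0 R) < 1]])).
apply: lift_exists => t; apply: continuous_comp; first exact: continuous_alpha.
exact: cts_fun.
Qed.

(** The two starting values lie in [0, 1) over the same point, hence agree, and uniqueness of lifts
    applies. *)
Lemma lift_alpha_eq (f : CS1 R) (h : unitI R -> R) : continuous h ->
  (forall t, cover_p (h t) = f (alpha t)) -> 0 <= h (I0 R) < 1 ->
  lift_alpha f = h.
Proof.
move=> ch hf h0; have [cl lf l0] := lift_alphaP f.
apply: lift_unique => // [t|]; first by rewrite lf hf.
by apply: cover_p_inj01 => //; rewrite lf hf.
Qed.

Lemma qtildeP (q : S1 R) : 0 <= qtilde q < 1 /\ cover_p (qtilde q) = q.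
Proof.
apply: (getPex (P := [set t : R | 0 <= t < 1 /\ cover_p t = q])).
by have [t t01 tq] := cover_p_surj q; exists t.
Qed.

Lemma alphaI0 : alpha (I0 R) = base R.
Proof. by apply: val_inj; rewrite /= mulr0 cos0 sin0. Qed.

Lemma alphaI1 : alpha (I1 R) = base R.
Proof.
by apply: val_inj; rewrite /= mulr1 mulr_natl cos2pi sin2pi.
Qed.

Lemma alpha_invK : cancel (@alpha_inv R) (@alpha R).
Proof.
move=> x; have [t /andP[t0 t1] tx] := cover_p_surj x.
have vt : val (clamp t) = t by rewrite val_clamp // t0 ltW.
rewrite /alpha_inv; case: xgetP => [s -> [_ ->] //|none].
(* Without a solution in (0, 1), [x] must be the base point, and the default value [I0] is still a
   preimage of it. *)
rewrite alphaI0 -tx; move: t0; rewrite le_eqVlt => /predU1P[<-|t0].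
  by apply: val_inj; rewrite /= mulr0 cos0 sin0.
by case: (none (clamp t)); split; rewrite ?/alpha vt ?t0.
Qed.

End Lifting.

(** * Uniform approximation by Bernstein polynomials *)

Section Bernstein.
Context {R : realType}.
Implicit Types (x : R) (phi psi : nat -> R).

(* The Bernstein polynomial [\sum_k phi k 'C(n, k) X^k (1 - X)^(n - k)], in
   de Casteljau's recursive form, which turns its properties into inductions. *)
Fixpoint bernstein n phi : {poly R} :=
  if n is n'.+1 then
    'X * bernstein n' (phi \o S) + (1 - 'X) * bernstein n' phi
  else (phi 0)%:P.

Lemma bernsteinS n phi x : (bernstein n.+1 phi).[x] =
  x * (bernstein n (phi \o S)).[x] + (1 - x) * (bernstein n phi).[x].
Proof. by rewrite /= !hornerE. Qed.

Lemma bernstein_at0 n phi : (bernstein n phi).[0] = phi 0.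
Proof.
elim: n phi => [|n IH] phi; first by rewrite /= hornerE.
by rewrite bernsteinS mul0r add0r subr0 mul1r IH.
Qed.

Lemma bernstein_at1 n phi : (bernstein n phi).[1] = phi n.
Proof.
elim: n phi => [|n IH] phi; first by rewrite /= hornerE.
by rewrite bernsteinS mul1r subrr mul0r addr0 IH.
Qed.

(** For [x] in [0, 1] each step of the recursion is a convex combination, so inequalities at the
    nodes are preserved. *)
Lemma ler_bernstein n phi psi x : 0 <= x <= 1 ->
  (forall k, (k <= n)%N -> phi k <= psi k) ->
  (bernstein n phi).[x] <= (bernstein n psi).[x].
Proof.
move=> /andP[x0 x1]; elim: n phi psi => [|n IH] phi psi le_phi.
  by rewrite /= !hornerE le_phi.
rewrite !bernsteinS lerD // ler_wpM2l ?subr_ge0 // IH // => k kn.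
  exact: le_phi.
by apply: le_phi; rewrite (leq_trans kn).
Qed.

(** Second moment of the binomial law about [c]: variance n x (1 - x) plus squared bias. The center
    stays general because the shift of the nodes in the recursion turns [c] into [c - 1]. *)
Lemma bernstein_variance n a b c x :
  (bernstein n (fun k => a + b * (k%:R - c) ^+ 2)).[x] =
  a + b * (n%:R * x * (1 - x) + (n%:R * x - c) ^+ 2).
Proof.
elim: n c => [|n IH] c; first by rewrite /= hornerE; ring.
have -> : (bernstein n.+1 (fun k => a + b * (k%:R - c) ^+ 2)).[x] =
    x * (bernstein n (fun k => a + b * (k%:R - (c - 1)) ^+ 2)).[x] +
    (1 - x) * (bernstein n (fun k => a + b * (k%:R - c) ^+ 2)).[x].
  rewrite bernsteinS; congr (_ * (bernstein _ _).[_] + _).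
  by apply/funext => k /=; rewrite -natr1; ring.
by rewrite !IH -natr1; ring.
Qed.

Lemma continuous_unitI_bounded (F : unitI R -> R) : continuous F ->
  exists2 M, 0 <= M & forall t, `|F t| <= M.
Proof.
move=> cF; have cN : {within [set: unitI R], continuous (fun t => `|F t|)}.
  by apply: continuous_subspaceT => t; exact: (cvg_norm (cF t)).
have [c _ cP] : exists2 c, c \in [set: unitI R] &
    forall t, t \in [set: unitI R] -> `|F t| <= `|F c|.
  by apply: compact_EVT_max => //; [exists (I0 R)|exact: unitI_compact].
by exists `|F c| => // t; apply: cP; rewrite inE.
Qed.

(** Korovkin's argument: at the nodes, [F] differs from [F t] by at most e/2 plus a multiple of the
    squared distance to [t]. Monotonicity passes this bound to the polynomial, and the variance
    makes the quadratic term small. *)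
Lemma poly_approx_endpoints (F : unitI R -> R) (e : R) :
  continuous F -> 0 < e -> exists r : {poly R},
    [/\ r.[0] = F (I0 R), r.[1] = F (I1 R) &
        forall t, `|F t - r.[val t]| <= e].
Proof.
move=> cF e0; have e20 : 0 < e / 2 by rewrite divr_gt0.
have [M M0 FM] := continuous_unitI_bounded cF.
have /unif_continuousP/(_ _ e20)[d /= d0 Fd] :=
  compact_unif_continuous unitI_compact cF.
have d20 : 0 < d ^+ 2 by rewrite exprn_gt0.
(* With this [K], the term K |x - k/n|^2 is at least 2 M, a bound for any difference of values of
   [F], once the distance reaches [d]. *)
pose K := 2 * M / d ^+ 2.
have K0 : 0 <= K by rewrite divr_ge0 ?mulr_ge0 // ltW.
pose n := (Num.bound (K / (e / 2))).+1.
have n0 : 0 < n%:R :> R by rewrite ltr0n.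
have Kn : K / n%:R <= e / 2.
  rewrite ler_pdivrMr // mulrC -ler_pdivrMr //; apply: ltW.
  apply: (@lt_trans _ _ (Num.bound (K / (e / 2)))%:R); last by rewrite ltr_nat.
  by apply: archi_boundP; rewrite divr_ge0 // ltW.
pose phi k := F (clamp (k%:R / n%:R)).
exists (bernstein n phi); split.
- by rewrite bernstein_at0 /phi mul0r clamp0.
- by rewrite bernstein_at1 /phi divff ?lt0r_neq0 // clamp1.
move=> t; have x01 := unitIP t; set x := val t in x01 *.
pose B := K / n%:R ^+ 2.
have near k : (k <= n)%N ->
    `|F t - phi k| <= e / 2 + B * (k%:R - n%:R * x) ^+ 2.
  move=> kn.
  have kn01 : 0 <= (k%:R / n%:R : R) <= 1.
    by apply/andP; split; [exact: divr_ge0|rewrite ler_pdivrMr // mul1r ler_nat].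
  have -> : B * (k%:R - n%:R * x) ^+ 2 = K * (k%:R / n%:R - x) ^+ 2.
    by rewrite /B; field; exact: lt0r_neq0.
  have [xd|dx] := ltP `|x - k%:R / n%:R| d.
    have : `|F t - phi k| < e / 2.
      apply: (Fd (t, clamp (k%:R / n%:R))).
      by suff : `|val t - val (clamp (k%:R / n%:R))| < d by []; rewrite val_clamp.
    by move=> /ltW /le_trans; apply; rewrite lerDl mulr_ge0 ?sqr_ge0.
  have le2M : `|F t - phi k| <= 2 * M.
    by rewrite mulr_natl mulr2n; apply: le_trans (ler_normB _ _) _; exact: (lerD (FM _) (FM _)).
  apply: le_trans le2M _.
  have -> : 2 * M = K * d ^+ 2 by rewrite /K divfK // lt0r_neq0.
  rewrite -[leLHS]add0r; apply: lerD; first exact: ltW.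
  apply: ler_wpM2l => //; rewrite -[leRHS]real_normK ?num_real // distrC.
  by rewrite ler_pXn2r // ?nnegrE // ltW.
(* Centering at the mean n x removes the bias term. *)
have var a b : (bernstein n (fun k => a + b * (k%:R - n%:R * x) ^+ 2)).[x] =
    a + b * (n%:R * x * (1 - x)).
  by rewrite bernstein_variance; ring.
have Bn : B * (n%:R * x * (1 - x)) <= e / 2.
  apply: le_trans Kn.
  have -> : B * (n%:R * x * (1 - x)) = K / n%:R * (x * (1 - x)).
    by rewrite /B; field; exact: lt0r_neq0.
  by apply: ler_piMr; [rewrite divr_ge0 // ltW|nra].
have up : (bernstein n phi).[x] <= (F t + e / 2) + B * (n%:R * x * (1 - x)).
  rewrite -var; apply: ler_bernstein => // k /near.
  by rewrite ler_norml; lra.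
have lo : (F t - e / 2) + (- B) * (n%:R * x * (1 - x)) <= (bernstein n phi).[x].
  rewrite -var; apply: ler_bernstein => // k /near.
  by rewrite ler_norml; lra.
by rewrite ler_norml; lra.
Qed.

End Bernstein.
(** Inherited from the plane by pulling neighborhoods back along [val]; it makes compact subsets of
    the circle closed. *)
Lemma S1_hausdorff {R : realType} : hausdorff_space (S1 R).
Proof.
move=> z w zw; apply: val_inj.
apply: (@norm_hausdorff R (R * R)%type) => A B.
by move=> /continuous_val Az /continuous_val Bw; have [v [? ?]] := zw _ _ Az Bw;
  exists (val v).
Qed.

(** * Passage between the interval and the circle, and density *)

Section Density.
Context {R : realType}.

(** [alpha] identifies only the two end points: parameters other than 1 lie in [0, 1), where
    [cover_p] is injective. *)
Lemma alpha_inj_ends (T : Type) (h : unitI R -> T) s t :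
  h (I0 R) = h (I1 R) -> alpha s = alpha t -> h s = h t.
Proof.
move=> h01 st; have /andP[s0 s1] := unitIP s; have /andP[t0 t1] := unitIP t.
have [vs|vs] := eqVneq (val s) 1; have [vt|vt] := eqVneq (val t) 1.
- by congr h; apply: val_inj; rewrite vs vt.
- have es : s = I1 R by apply: val_inj.
  have : cover_p 0 = cover_p (val t).
    by move: st; rewrite es alphaI1 -alphaI0.
  move=> /cover_p_inj01 t0e; rewrite es -h01; congr h; apply: val_inj => /=.
  by apply: t0e; rewrite ?lexx ?ltr01 // t0 lt_neqAle vt t1.
- have et : t = I1 R by apply: val_inj.
  have : cover_p (val s) = cover_p 0.
    by move: st; rewrite et alphaI1 -alphaI0.
  move=> /cover_p_inj01 s0e; rewrite et -h01; congr h; apply: val_inj => /=.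
  by apply: s0e; rewrite ?lexx ?ltr01 // s0 lt_neqAle vs s1.
- congr h; apply: val_inj; apply: cover_p_inj01 st.
    by rewrite s0 lt_neqAle vs s1.
  by rewrite t0 lt_neqAle vt t1.
Qed.

(** [alpha_inv] sends the base point to 0, so t = 1 is not recovered, but [h] does not see the
    difference. *)
Lemma comp_alpha_invK (T : Type) (h : unitI R -> T) t :
  h (I0 R) = h (I1 R) -> h (alpha_inv (alpha t)) = h t.
Proof. by move=> h01; apply: alpha_inj_ends; rewrite ?alpha_invK. Qed.

(* [alpha] is a closed map, hence a quotient map. *)
Lemma continuous_comp_alpha_inv (T : topologicalType) (h : unitI R -> T) :
  continuous h -> h (I0 R) = h (I1 R) -> continuous (h \o @alpha_inv R).
Proof.
move=> /continuous_closedP ch h01; apply/continuous_closedP => A cA.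
have -> : (h \o @alpha_inv R) @^-1` A = @alpha R @` (h @^-1` A).
  apply/seteqP; split => [x /= Ax|_ [t At <-] /=].
    by exists (alpha_inv x) => //; rewrite alpha_invK.
  by rewrite comp_alpha_invK.
apply: compact_closed; first exact: S1_hausdorff.
apply: continuous_compact; first exact/continuous_subspaceT/continuous_alpha.
by apply: (subclosed_compact _ unitI_compact) => //; exact: ch.
Qed.

Lemma continuous_horner_unitI (r : {poly R}) :
  continuous (fun t : unitI R => r.[val t]).
Proof.
move=> t; apply: (@continuous_comp (unitI R) R R (fun s => val s)).
  exact: continuous_val.
exact: continuous_horner.
Qed.

Lemma cover_pD_int (t : R) (m : int) : cover_p (t + m%:~R) = cover_p t.
Proof.
have cn n : cos (2 * pi * n%:R) = 1 :> R.
  by rewrite mulr_natr mulr_natl -[X in cos X]add0r (periodicn (@cosD2pi R)) cos0.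
apply/cover_p_eqP; rewrite addrAC subrr add0r; case: m => n; first exact: cn.
by rewrite NegzE mulrNz mulrN cosN; exact: cn.
Qed.

Lemma poly_map_exists (q : S1 R) (m : int) (r : {poly R}) :
  r.[0] = qtilde q -> r.[1] = qtilde q + m%:~R ->
  exists2 g : CS1 R, Pqm q m g & lift_alpha g = fun t => r.[val t].
Proof.
move=> r0 r1; have [q01 pq] := qtildeP q.
pose h t : S1 R := cover_p r.[val (t : unitI R)].
have ch : continuous h.
  move=> t; apply: (@continuous_comp (unitI R) R (S1 R) (fun t => r.[val t])).
    exact: continuous_horner_unitI.
  exact: continuous_cover_p.
have h01 : h (I0 R) = h (I1 R).
  by rewrite /h /= r0 r1 cover_pD_int.
pose g : CS1 R := mkcts (continuous_comp_alpha_inv ch h01).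
have lg : lift_alpha g = fun t => r.[val t].
  apply: lift_alpha_eq; first exact: continuous_horner_unitI.
    by move=> t; rewrite [RHS](comp_alpha_invK _ h01).
  by rewrite /= r0.
exists g => //; split; last by rewrite lg /= r0.
by rewrite lg; exists r.
Qed.

Lemma d0_le (f g : CS1 R) (e : R) :
  (forall t, `|lift_alpha f t - lift_alpha g t| <= e) -> d0 f g <= 2 * pi * e.
Proof.
move=> fg; rewrite /d0 ler_pM2l ?mulr_gt0 ?pi_gt0 //; apply: ge_sup.
  (* Bounding the supremum requires a nonempty set: parameter 1/2 gives (-1, 0), which is not the
     base point. *)
  exists `|lift_alpha f (alpha_inv (cover_p 2^-1)) -
           lift_alpha g (alpha_inv (cover_p 2^-1))|.
  exists (cover_p 2^-1) => //= /(congr1 val) [c1 _].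
  move: c1; rewrite mulrAC divff ?pnatr_eq0 // mul1r cospi; lra.
by move=> _ [x _ <-].
Qed.

Lemma Pqm_sub_Cqm (q : S1 R) (m : int) : Pqm q m `<=` @Cqm R q m.
Proof.
move=> f [[r [r0 r1] rf] pf]; have [_ fa _] := lift_alphaP f; split.
  by rewrite -alphaI0 -fa.
by rewrite /winding -rf /= r0 r1 addrAC subrr add0r.
Qed.

End Density.

Theorem theorem3p3 (R : realType) (q : S1 R) (m : int) :
  dense_in (@d0 R) (@Pqm R q m) (@Cqm R q m).
Proof.
split=> [|f [fq fm] e e0]; first exact: Pqm_sub_Cqm.
have [cl fa f0] := lift_alphaP f; have [q01 pq] := qtildeP q.
have F0 : lift_alpha f (I0 R) = qtilde q.
  by apply: cover_p_inj01 => //; rewrite fa alphaI0 fq pq.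
have F1 : lift_alpha f (I1 R) = qtilde q + m%:~R.
  by rewrite -fm /winding F0 addrC subrK.
have pi20 : 0 < 2 * pi :> R by rewrite mulr_gt0 ?pi_gt0.
(* Dividing by 2 pi cancels the factor in [d0]; the half turns the weak bound of [d0_le] into a
   strict one. *)
have e'0 : 0 < e / 2 / (2 * pi) by rewrite !divr_gt0.
have [r [r0 r1 fr]] := poly_approx_endpoints cl e'0.
rewrite F0 in r0; rewrite F1 in r1.
have [g Pg lg] := poly_map_exists r0 r1; exists g => //.
apply: (@le_lt_trans _ _ (e / 2)); last by rewrite ltr_pdivrMr // ltr_pMr // ltr1n.
have := @d0_le _ f g (e / 2 / (2 * pi)); rewrite [2 * pi * _]mulrC divfK ?lt0r_neq0 //.
by apply => t; rewrite lg; exact: fr.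
Qed.
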